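(* For every $n\in\mathbb{Z}_{>0}$, let $\boldsymbol{\sigma}^n$ be a random permutation of size $n$ and $\boldsymbol{i}_n$ be a uniform random index in $[n]$, independent of $\boldsymbol{\sigma}^n$. Then the following are equivalent: (a) there exists a random rooted infinite permutation $\boldsymbol{\sigma}^\infty$ such that $(\boldsymbol{\sigma}^n)$ converges to $\boldsymbol{\sigma}^\infty$ in the annealed Benjamini--Schramm sense, i.e. $(\boldsymbol{\sigma}^n,\boldsymbol{i}_n)\to\boldsymbol{\sigma}^\infty$ in distribution with respect to the local distance $d$ on $\tilde{\mathcal{S}}_\bullet$; (b) for all $h\in\mathbb{Z}_{>0}$, there exist non-negative real numbers $(\Gamma^h_\pi)_{\pi\in\mathcal{S}^{2h+1}}$ such that $\mathbb{P}\big(r_h(\boldsymbol{\sigma}^n,\boldsymbol{i}_n)=(\pi,h+1)\big)\to\Gamma^h_\pi$ as $n\to\infty$, for all $\pi\in\mathcal{S}^{2h+1}$; (c) there exist non-negative real numbers $(\Delta_\pi)_{\pi\in\mathcal{S}}$ such that for all patterns $\pi\in\mathcal{S}$, $\mathbb{E}[\widetilde{\mathrm{c\text{-}occ}}(\pi,\boldsymbol{\sigma}^n)]\to\Delta_\pi$ as $n\to\infty$. Moreover, if one of the three conditions holds (and so all of them), then for every fixed $h\in\mathbb{Z}_{>0}$, $$\mathbb{P}\big(r_h(\boldsymbol{\sigma}^\infty)=(\pi,h+1)\big)=\Delta_\pi=\Gamma^h_\pi\quad\text{for all }\pi\in\mathcal{S}^{2h+1}.$$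
   Context: All intervals $[a,b]$ are integer intervals. $\mathcal{S}^n$ is the set of permutations $\sigma=\sigma_1\cdots\sigma_n$ of $[n]=\{1,\dots,n\}$, $|\sigma|=n$ is the size, and $\mathcal{S}=\bigcup_{n\ge1}\mathcal{S}^n$. For $I\subseteq[n]$, $\mathrm{pat}_I(\sigma)$ is the permutation of size $|I|$ in the same relative order as $(\sigma_i)_{i\in I}$. For $\pi\in\mathcal{S}$, $\mathrm{c\text{-}occ}(\pi,\sigma)$ is the number of intervals $I\subseteq[n]$ with $|I|=|\pi|$ and $\mathrm{pat}_I(\sigma)=\pi$, and $\widetilde{\mathrm{c\text{-}occ}}(\pi,\sigma)=\mathrm{c\text{-}occ}(\pi,\sigma)/n$ where $n=|\sigma|$. Rooted permutations. A finite rooted permutation is a pair $(\sigma,i)$ with $\sigma\in\mathcal{S}^n$, $i\in[n]$. It is identified with the pair $(A_{\sigma,i},\preccurlyeq_{\sigma,i})$, where $A_{\sigma,i}=[-i+1,|\sigma|-i]$ and $\preccurlyeq_{\sigma,i}$ is the total order on it given by $\ell\preccurlyeq_{\sigma,i}j\iff\sigma_{\ell+i}\le\sigma_{j+i}$; this is a bijection between finite rooted permutations and total orders on finite integer intervals containing $0$. An infinite rooted permutation is a pair $(A,\preccurlyeq)$ with $A$ an infinite integer interval containing $0$ and $\preccurlyeq$ a total order on $A$. $\tilde{\mathcal{S}}_\bullet$ is the set of all finite and infinite rooted permutations. For $h\in\mathbb{Z}_{>0}$, $r_h(A,\preccurlyeq)=(A\cap[-h,h],\preccurlyeq)$. The local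 distance on $\tilde{\mathcal{S}}_\bullet$ is $d(x,y)=2^{-\sup\{h\in\mathbb{Z}_{>0}:\,r_h(x)=r_h(y)\}}$, with $\sup\emptyset=0$, $\sup\mathbb{Z}_{>0}=+\infty$, $2^{-\infty}=0$. *)

(* Defs.v *)
From HB Require Import structures.
From mathcomp Require Import all_boot all_order all_algebra perm.
From mathcomp Require Import all_classical all_reals all_analysis.
From mathcomp Require Import zify.

Set Implicit Arguments.
Unset Strict Implicit.
Unset Printing Implicit Defensive.

Import Order.TTheory GRing.Theory Num.Theory.
Import numFieldNormedType.Exports.

Local Open Scope ring_scope.

(* Permutations of [n] are the permutations ['S_n] of ['I_n], so positions and
   values are shifted by one: the position [i : 'I_n] is the position [i + 1]
   of [n]. *)

Section Pattern.
Variables (n : nat) (I : {set 'I_n}) (s : 'S_n).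
Local Open Scope nat_scope.

(* [enum_val : 'I_#|I| -> 'I_n] lists the elements of [I] in increasing order;
   the value of the pattern at [a] is the rank of [s (enum_val a)] among the
   values of [s] on [I]. *)
Definition pat_rank (a : 'I_#|I|) : nat :=
  #|[set b : 'I_#|I| | s (enum_val b) < s (enum_val a)]|.

Lemma pat_rank_lt a : pat_rank a < #|I|.
Proof.
rewrite -[X in _ < X]card_ord -cardsT; apply: proper_card.
apply/properP; split; first by apply/fintype.subsetP => b; rewrite !finset.inE.
by exists a; rewrite !finset.inE ?ltnn.
Qed.

Lemma pat_rank_mono a b :
  s (enum_val a) < s (enum_val b) -> pat_rank a < pat_rank b.
Proof.
move=> sab; apply: proper_card; apply/properP; split.
  by apply/fintype.subsetP => c; rewrite !finset.inE => /ltn_trans; apply.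
by exists a; rewrite !finset.inE // ltnn.
Qed.

Lemma pat_rank_inj : injective (fun a => Ordinal (pat_rank_lt a)).
Proof.
move=> a b [] rab; apply: enum_val_inj; apply: (@perm_inj _ s).
apply: val_inj; apply/eqP; rewrite eqn_leq leqNgt [X in _ && X]leqNgt.
by apply/andP; split; apply/negP => /pat_rank_mono; rewrite rab ltnn.
Qed.

Definition pat : 'S_#|I| := perm pat_rank_inj.

Definition is_int_interval : bool :=
  [forall i in I, forall j in I, forall k : 'I_n,
     (i <= k <= j) ==> (k \in I)].

End Pattern.

(* The permutations are compared as elements of the union of all the ['S_m],
   so that equality includes [#|I| = k]. *)
Definition cocc (k : nat) (p : 'S_k) (n : nat) (s : 'S_n) : nat :=
  #|[set I : {set 'I_n} | is_int_interval I &
       (Tagged (fun m => 'S_m) (pat I s) == Tagged (fun m => 'S_m) p)]|.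

Definition cocc_prop (R : realType) (k : nat) (p : 'S_k) (n : nat) (s : 'S_n)
  : R := (cocc p s)%:R / n%:R.

Local Open Scope classical_set_scope.

(* A total order on an integer interval containing 0. The order is a relation
   on [int] that only relates points of the interval, so that equality of
   rooted permutations is equality of the pairs (interval, order). The interval
   may be finite or infinite. *)
Definition is_rooted (A : set int) (le : int -> int -> Prop) : Prop :=
  [/\ A 0 /\ (forall x y z, A x -> A z -> x <= y <= z -> A y),
      forall x y, le x y -> A x /\ A y,
      forall x y, A x -> A y -> le x y \/ le y x,
      forall x y, le x y -> le y x -> x = y &
      forall x y z, le x y -> le y z -> le x z].

Record rooted_perm := RootedPerm {
  rdom : set int;
  rle : int -> int -> Prop;
  rooted_permP : is_rooted rdom rle }.

Definition rooted_infinite (x : rooted_perm) : Prop := infinite_set (rdom x).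

Lemma rooted_perm_eq (x y : rooted_perm) :
  rdom x = rdom y -> (forall l j, rle x l j <-> rle y l j) -> x = y.
Proof.
case: x y => [A le HA] [B le' HB] /= AB lele'; subst B.
have Ele : le = le'.
  by apply/funext => l; apply/funext => j; apply/propext; exact: lele'.
by subst le'; congr RootedPerm; exact: Prop_irrelevance.
Qed.

(* The interval [-i + 1, |s| - i] for the root i of [n] (see above) is
   [- i, n - 1 - i] for [i : 'I_n]. *)
Definition finite_dom (n : nat) (i : 'I_n) : set int :=
  [set l | - (i : nat)%:Z <= l < n%:Z - (i : nat)%:Z].

Definition finite_le (n : nat) (s : 'S_n) (i : 'I_n) (l j : int) : Prop :=
  exists a b : 'I_n, [/\ (a : nat)%:Z = l + (i : nat)%:Z,
                         (b : nat)%:Z = j + (i : nat)%:Z &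
                         (s a <= s b)%N].

Lemma finite_domP n (i : 'I_n) l : finite_dom i l ->
  exists a : 'I_n, (a : nat)%:Z = l + (i : nat)%:Z.
Proof.
rewrite /finite_dom /= => Hl.
have lt : (`|(l + (i : nat)%:Z)%R| < n)%N by have := ltn_ord i; lia.
by exists (Ordinal lt) => /=; lia.
Qed.

Lemma finite_is_rooted n (s : 'S_n) (i : 'I_n) :
  is_rooted (finite_dom i) (finite_le s i).
Proof.
split.
- split; first by rewrite /finite_dom /=; have := ltn_ord i; lia.
  by move=> x y z; rewrite /finite_dom /=; lia.
- move=> x y [a [b [Ha Hb _]]]; rewrite /finite_dom /=.
  by have := ltn_ord a; have := ltn_ord b; lia.
- move=> x y /finite_domP[a Ha] /finite_domP[b Hb].
  by have /orP[sab|sba] := leq_total (s a) (s b);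
    [left; exists a, b | right; exists b, a].
- move=> x y [a [b [Ha Hb sab]]] [b' [a' [Hb' Ha' sba]]].
  have Ea : a' = a by apply: val_inj => /=; lia.
  have Eb : b' = b by apply: val_inj => /=; lia.
  subst a' b'.
  have /perm_inj Eab : s a = s b by apply: val_inj => /=; lia.
  by subst b; lia.
- move=> x y z [a [b [Ha Hb sab]]] [b' [c [Hb' Hc sbc]]].
  have Eb : b' = b by apply: val_inj => /=; lia.
  by subst b'; exists a, c; split => //; exact: leq_trans sbc.
Qed.

Definition rooted (n : nat) (s : 'S_n) (i : 'I_n) : rooted_perm :=
  RootedPerm (finite_is_rooted s i).

Lemma restr_is_rooted (h : nat) (x : rooted_perm) :
  is_rooted (rdom x `&` [set l | - h%:Z <= l <= h%:Z])
    (fun l j => [/\ rle x l j, - h%:Z <= l <= h%:Z & - h%:Z <= j <= h%:Z]).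
Proof.
case: x => A le [] /= [A0 Aint] leA letot leanti letrans.
split.
- split; first by split => //=; lia.
  move=> a b c [Aa /= ha] [Ac /= hc] abc.
  by split => /=; [exact: (Aint a b c) | lia].
- by move=> l j [/leA[]].
- move=> l j [Al /= hl] [Aj /= hj].
  by have [H|H] := letot l j Al Aj; [left|right].
- by move=> l j [H1 _ _] [H2 _ _]; exact: leanti.
- by move=> l j k [H1 ? _] [H2 _ ?]; split => //; exact: letrans H2.
Qed.

Definition restr (h : nat) (x : rooted_perm) : rooted_perm :=
  RootedPerm (restr_is_rooted h x).

Lemma restr_eqP h (x y : rooted_perm) :
  restr h x = restr h y <->
  (forall l j, - h%:Z <= l <= h%:Z -> - h%:Z <= j <= h%:Z ->
     (rdom x l <-> rdom y l) /\ (rle x l j <-> rle y l j)).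
Proof.
split => [E l j hl hj|H].
- split.
    have : rdom (restr h x) l <-> rdom (restr h y) l by rewrite E.
    by move=> /= [H1 H2]; split => [H|H]; [case: H1|case: H2].
  have : rle (restr h x) l j <-> rle (restr h y) l j by rewrite E.
  by move=> /= [H1 H2]; split => [H|H]; [case: H1|case: H2].
- apply: rooted_perm_eq => /=.
    by apply/seteqP; split => l /= [Hl hl]; split => //;
      apply/(H l l hl hl).1.
  by move=> l j; split => -[Hlj hl hj]; split => //; apply/(H l j hl hj).2.
Qed.

Lemma restr_eq_le h h' (x y : rooted_perm) : (h' <= h)%N ->
  restr h x = restr h y -> restr h' x = restr h' y.
Proof.
move=> hh' /restr_eqP H; apply/restr_eqP => l j hl hj.
by apply: H; lia.
Qed.

Lemma restr_eq_all (x y : rooted_perm) :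
  (forall h0, exists2 h, (h0 <= h)%N & restr h x = restr h y) -> x = y.
Proof.
move=> H; have {}H h : restr h x = restr h y.
  by have [h' hh' /(restr_eq_le hh')] := H h.
apply: rooted_perm_eq => [|l j].
  apply/seteqP; split=> l.
    by have /restr_eqP/(_ l l) := H `|l|%N; case; [lia|lia|move=> [? _] _].
  by have /restr_eqP/(_ l l) := H `|l|%N; case; [lia|lia|move=> [_ ?] _].
by have /restr_eqP/(_ l j) := H (`|l| + `|j|)%N; case; [lia|lia|].
Qed.

Section LocalDist.
Variable R : realType.
Implicit Types x y z : rooted_perm.

Definition agree_set x y : set (\bar R) :=
  [set (h%:R)%:E | h in [set h | (0 < h)%N /\ restr h x = restr h y]].

(* [maxe 0] only serves the convention sup set0 = 0, since [ereal_sup set0] is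
   [-oo]. *)
Definition agree_height x y : \bar R := maxe 0%E (ereal_sup (agree_set x y)).

(* [-oo] is not a value of [agree_height]. *)
Definition pow2N (u : \bar R) : R := if u is r%:E then 2 `^ (- r) else 0.

Definition local_dist x y : R := pow2N (agree_height x y).

Lemma pow2N_ge0 u : 0 <= pow2N u.
Proof. by case: u => //= r; exact: powR_ge0. Qed.

Lemma pow2N_anti u v : (0 <= u)%E -> (u <= v)%E -> pow2N v <= pow2N u.
Proof.
case: u v => [r| |] [t| |] //= _; rewrite ?powR_ge0 ?lee_fin => rt.
by rewrite ler_powR ?ler1n// lerN2.
Qed.

Lemma agree_height_ge0 x y : (0 <= agree_height x y)%E.
Proof. by rewrite /agree_height le_max lexx. Qed.

Lemma local_dist_le x y z w :
  agree_set x y `<=` agree_set z w -> local_dist z w <= local_dist x y.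
Proof.
move=> H; apply: pow2N_anti; first exact: agree_height_ge0.
rewrite /agree_height ge_max le_max lexx /= le_max.
by apply/orP; right; exact: ereal_sup_le.
Qed.

Lemma agree_height_pinfty x y : agree_height x y = +oo%E <->
  forall h0, exists2 h, (h0 <= h)%N & restr h x = restr h y.
Proof.
split=> [E h0|H].
- apply: contrapT => /forall2NP Hn; move: E; apply/eqP; rewrite -ltey.
  apply: (@le_lt_trans _ _ (h0%:R)%:E); last exact: ltry.
  rewrite /agree_height ge_max lee_fin ler0n /=.
  apply: ge_ereal_sup => _ [h [_ hxy] <-].
  rewrite lee_fin ler_nat; have [//|/ltnW hh] := leqP h h0.
  by case: (Hn h) => [/(_ hh)|/(_ hxy)].
- apply/eqyP => A A0.
  have [h hA hxy] := H (Num.bound A).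
  rewrite /agree_height le_max; apply/orP; right.
  apply: (@le_trans _ _ (h%:R)%:E).
    rewrite lee_fin (le_trans (ler_norm _))//.
    by rewrite (le_trans (ltW (archi_boundP (normr_ge0 _))))// gtr0_norm// ler_nat.
  apply: ereal_sup_ubound; exists h => //; split=> //.
  apply: leq_trans hA.
  by have := archi_boundP (ltW A0); case: (Num.bound A) => // /(lt_trans A0); rewrite ltxx.
Qed.

Lemma local_distxx x : local_dist x x = 0.
Proof. by rewrite /local_dist (agree_height_pinfty x x).2 // => h; exists h. Qed.

Lemma local_dist_positivity x y : local_dist x y = 0 -> x = y.
Proof.
move=> d0; apply/restr_eq_all/agree_height_pinfty; move: d0.
rewrite /local_dist; have := agree_height_ge0 x y.
case: agree_height => //= r _ /eqP.
by rewrite gt_eqF // powR_gt0.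
Qed.

Lemma local_dist_sym x y : local_dist x y = local_dist y x.
Proof.
by apply/eqP; rewrite eq_le; apply/andP; split; apply: local_dist_le;
  move=> _ [h [h0 E] <-]; exists h.
Qed.

Lemma local_dist_triangle y x z :
  local_dist x z <= local_dist x y + local_dist y z.
Proof.
have d0 a b : 0 <= local_dist a b by exact: pow2N_ge0.
have [H|] := pselect (agree_set x y `<=` agree_set y z).
  apply: (@le_trans _ _ (local_dist x y)); last by rewrite lerDl.
  apply: local_dist_le => _ [h [h0 E] <-]; exists h => //; split => //.
  have [h' [_ E'] /eqP] : agree_set y z (h%:R)%:E by apply: H; exists h.
  by rewrite eqe eqr_nat => /eqP hh'; rewrite E -hh'.
move=> /existsNP[_ /not_implyP[[h [h0 Exy] <-] nyz]].
apply: (@le_trans _ _ (local_dist y z)); last by rewrite lerDr.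
apply: local_dist_le => _ [k [k0 Eyz] <-]; exists k => //; split => //.
rewrite -Eyz; have [kh|hk] := leqP k h; first exact: restr_eq_le Exy.
by case: nyz; exists h => //; split => //; exact: restr_eq_le (ltnW hk) Eyz.
Qed.

End LocalDist.

(* The carrier records [R] because the values of the distance are in [R]. *)
Definition rooted_space (R : realType) : Type := rooted_perm.

HB.instance Definition _ (R : realType) := gen_eqMixin (rooted_space R).
HB.instance Definition _ (R : realType) := gen_choiceMixin (rooted_space R).
HB.instance Definition _ (R : realType) := isPointed.Build (rooted_space R)
  (rooted (1%g : 'S_1) ord0).
HB.instance Definition _ (R : realType) :=
  isMetric.Build R (rooted_space R) (@local_distxx R)
    (@local_dist_positivity R) (@local_dist_sym R) (@local_dist_triangle R).

Section Borel.
Variable R : realType.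
Let open_sets : set (set (rooted_space R)) := open.

HB.instance Definition _ := @isMeasurable.Build (sigma_display open_sets)
  (rooted_space R) <<s open_sets >> (@sigma_algebra0 _ setT open_sets)
  (@sigma_algebraC _ open_sets) (@sigma_algebra_bigcup _ setT open_sets).
End Borel.

HB.instance Definition _ (T : finType) :=
  isPointed.Build (perm_type T) (1%g : {perm T}).
HB.instance Definition _ (T : finType) := @isMeasurable.Build
  default_measure_display (perm_type T) discrete_measurable discrete_measurable0
  discrete_measurableC discrete_measurableU.

HB.instance Definition _ (n : nat) := isPointed.Build 'I_n.+1 ord0.
HB.instance Definition _ (n : nat) := @isMeasurable.Build
  default_measure_display 'I_n.+1 discrete_measurable discrete_measurable0
  discrete_measurableC discrete_measurableU.

Section Probability.
Context (R : realType) (d : measure_display) (T : measurableType d).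
Variable P : probability T R.
Local Open Scope ereal_scope.

Definition independent_RV (d1 d2 : measure_display) (T1 : measurableType d1)
    (T2 : measurableType d2) (X : {RV P >-> T1}) (Y : {RV P >-> T2}) : Prop :=
  forall (A : set T1) (B : set T2), measurable A -> measurable B ->
    P (X @^-1` A `&` Y @^-1` B) = P (X @^-1` A) * P (Y @^-1` B).

Definition uniform_index (n : nat) (i : {RV P >-> 'I_n.+1}) : Prop :=
  forall k : 'I_n.+1, P (i @^-1` [set k]) = (n.+1%:R^-1)%:E.

Definition rooted_RV_fun (n : nat) (s : {RV P >-> 'S_n.+1})
    (i : {RV P >-> 'I_n.+1}) : T -> rooted_space R :=
  fun w => rooted (s w) (i w).

Lemma measurable_rooted_RV n (s : {RV P >-> 'S_n.+1}) (i : {RV P >-> 'I_n.+1}) :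
  measurable_fun setT (rooted_RV_fun s i).
Proof.
move=> _ B _; rewrite setTI.
have -> : rooted_RV_fun s i @^-1` B =
    \bigcup_(q in [set q : 'S_n.+1 * 'I_n.+1 | B (rooted q.1 q.2)])
      (s @^-1` [set q.1] `&` i @^-1` [set q.2]).
  apply/seteqP; split => w /=; first by exists (s w, i w).
  by move=> [[p k] /= Bpk [Ep Ek]]; rewrite /rooted_RV_fun Ep Ek.
apply: fin_bigcup_measurable; first exact: finite_finset.
by move=> q _; apply: measurableI; rewrite -[X in measurable X]setTI;
  exact: measurable_funPT.
Qed.

HB.instance Definition _ n (s : {RV P >-> 'S_n.+1}) (i : {RV P >-> 'I_n.+1}) :=
  isMeasurableFun.Build _ _ T (rooted_space R) (rooted_RV_fun s i)
    (measurable_rooted_RV s i).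

Definition rooted_RV (n : nat) (s : {RV P >-> 'S_n.+1})
    (i : {RV P >-> 'I_n.+1}) : {RV P >-> rooted_space R} :=
  rooted_RV_fun s i.

End Probability.

(* The random elements may live on different probability spaces. *)
Definition cvg_in_distribution (R : realType) (d : nat -> measure_display)
    (T : forall n, measurableType (d n)) (P : forall n, probability (T n) R)
    (X : forall n, {RV (P n) >-> rooted_space R})
    (d' : measure_display) (T' : measurableType d') (P' : probability T' R)
    (Y : {RV P' >-> rooted_space R}) : Prop :=
  forall f : rooted_space R -> R, continuous f ->
    (exists M : R, forall x, `|f x| <= M) ->
    ('E_(P n)[f \o X n] @[n --> \oo] --> 'E_P'[f \o Y])%E.

Section MainConditions.
Context (R : realType) (d : nat -> measure_display)
  (T : forall n, measurableType (d n)) (P : forall n, probability (T n) R)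
  (sigma : forall n, {RV (P n) >-> 'S_n.+1})
  (i : forall n, {RV (P n) >-> 'I_n.+1}).

Definition BS_limit (d' : measure_display) (T' : measurableType d')
    (P' : probability T' R) (X : {RV P' >-> rooted_space R}) : Prop :=
  (forall w, rooted_infinite (X w)) /\
  cvg_in_distribution (fun n => rooted_RV (sigma n) (i n)) X.

(* The root h + 1 of [2h + 1] is [inord h : 'I_h.*2.+1]. *)
Definition ball_limit (h : nat) (Gamma : 'S_h.*2.+1 -> R) : Prop :=
  forall p : 'S_h.*2.+1, 0 <= Gamma p /\
    (P n [set w | restr h (rooted (sigma n w) (i n w)) = rooted p (inord h)]
       @[n --> \oo] --> (Gamma p)%:E)%E.

Definition cocc_limit (Delta : forall k, 'S_k.+1 -> R) : Prop :=
  forall (k : nat) (p : 'S_k.+1), 0 <= Delta k p /\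
    ('E_(P n)[fun w => cocc_prop R p (sigma n w)]
       @[n --> \oo] --> (Delta k p)%:E)%E.

End MainConditions.

(* Main.v *)
(** The mean proportion of consecutive occurrences of [p] of size [2h + 1] is
    exactly the probability that the ball of radius [h] around the uniform root
    is [p]. Extending the window of an occurrence changes this proportion by
    [O(1/n)], so that the limits of the pattern proportions determine, and are
    determined by, those of the balls, and form a consistent family: each is the
    sum of the limits over the one-step extensions of the pattern.

    A limiting random order on the integers is read off a uniform point of
    [[0, 1[]: each pattern of size [2h + 1] is given a subinterval whose length
    is its limiting proportion, and the subintervals of its extensions subdivide
    it. For a continuous [f] bounded by [M], the infima of [f] on the cylinders of
    radius [h] increase to [f] as [h] grows; hence dominated convergence in [h]
    gives [liminf E f(X_n) >= E f(X)], and the same for [- f] yields convergence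
    in distribution without any compactness argument. *)
From HB Require Import structures.
Require Import Defs.
From mathcomp Require Import all_boot all_order all_algebra perm.
From mathcomp Require Import all_classical all_reals all_analysis.
From mathcomp Require Import zify lra.

Set Implicit Arguments.
Unset Strict Implicit.
Unset Printing Implicit Defensive.

Import Order.TTheory GRing.Theory Num.Theory.
Import numFieldNormedType.Exports.

Local Open Scope ring_scope.

(** * Consecutive occurrences counted by their starting positions *)

Section Occurrences.
Local Open Scope nat_scope.

Lemma card_ord_lt m (x : 'I_m) : #|[set b : 'I_m | b < x]| = x.
Proof.
rewrite cardE -(size_map val) -[RHS](size_iota 0).
apply: perm_size; apply: uniq_perm; last 1 first.
- move=> y; rewrite mem_iota /=; apply/mapP/idP => [[b]|yx].
    by rewrite mem_enum finset.inE => ? ->.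
have ym : y < m by exact: ltn_trans (ltn_ord x).
by exists (Ordinal ym); rewrite ?mem_enum ?finset.inE.
- by rewrite map_inj_uniq ?enum_uniq //; exact: val_inj.
- exact: iota_uniq.
Qed.

(** Each value [r a] is the number of [b] with [r b < r a], so the order of the values determines
    the permutation. *)
Lemma perm_le_inj m (p q : 'S_m) :
  (forall a b, (p a <= p b) = (q a <= q b)) -> p = q.
Proof.
have rankE (r : 'S_m) a : r a = #|[set b | r b < r a]| :> nat.
  rewrite -[LHS]card_ord_lt -(card_imset _ (@perm_inj _ r)); congr #|pred_of_set _|.
  apply/setP => y; rewrite finset.inE; apply/idP/imsetP => [yr|[b]].
    by exists (r^-1 y)%g; rewrite ?finset.inE permKV.
  by rewrite finset.inE => ? ->.
move=> pq; apply/permP => a; apply: val_inj; rewrite /= (rankE p) (rankE q).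
by congr #|pred_of_set _|; apply/setP => b; rewrite !finset.inE !ltnNge pq.
Qed.

(** The standardization of [f]: each [a] is sent to the rank of [f a] among the values of [f]. *)
Lemma perm_of_order m (f : 'I_m -> nat) : injective f ->
  exists p : 'S_m, forall a b, (p a <= p b) = (f a <= f b).
Proof.
move=> finj; pose r a := #|[set b | f b < f a]|.
have rmono a b : f a < f b -> r a < r b.
  move=> ab; apply: proper_card; apply/properP; split.
    by apply/fintype.subsetP => c; rewrite !finset.inE => /ltn_trans; apply.
  by exists a; rewrite !finset.inE ?ltnn.
have rle a b : (r a <= r b) = (f a <= f b).
  have [ab|ba|/finj->] := ltngtP (f a) (f b); last by rewrite leqnn.
    by rewrite ltnW // rmono.
  by rewrite leqNgt rmono.
have rm a : r a < m.
  rewrite -[X in _ < X]card_ord -cardsT; apply: proper_card; apply/properP.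
  split; first by apply/fintype.subsetP => b; rewrite !finset.inE.
  by exists a; rewrite !finset.inE ?ltnn.
have rinj : injective (fun a => Ordinal (rm a)).
  move=> a b [rab]; apply: finj; apply/eqP.
  by rewrite eqn_leq -!rle rab leqnn.
by exists (perm rinj) => a b; rewrite !permE /= rle.
Qed.

(** Comparing orders instead of permutations avoids the type ['S_#|I|] of [pat]. As [p] has size
    [k + 1], the window is [[j, j + k]] in [[0, n]], and the bound [j + k <= n] makes every [inord]
    exact. *)
Definition occ k (p : 'S_k.+1) n (s : 'S_n.+1) (j : nat) : bool :=
  (j + k <= n) && [forall a : 'I_k.+1, forall b : 'I_k.+1,
    (p a <= p b) == (s (inord (j + a)) <= s (inord (j + b)))].

Lemma occP k (p : 'S_k.+1) n (s : 'S_n.+1) j :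
  reflect (j + k <= n /\ forall a b : 'I_k.+1,
     (p a <= p b) = (s (inord (j + a)) <= s (inord (j + b))))
    (occ p s j).
Proof.
apply: (iffP andP) => -[jk H]; split => //.
  by move=> a b; move/forallP: H => /(_ a)/forallP/(_ b)/eqP.
by apply/forallP => a; apply/forallP => b; rewrite H.
Qed.

Lemma occ_inj k (p q : 'S_k.+1) n (s : 'S_n.+1) j :
  occ p s j -> occ q s j -> p = q.
Proof. by move=> /occP[_ H] /occP[_ H']; apply: perm_le_inj => a b; rewrite H. Qed.

Lemma occ_exists k n (s : 'S_n.+1) j : j + k <= n ->
  exists p : 'S_k.+1, occ p s j.
Proof.
move=> jk; have /perm_of_order[p Hp] :
    injective (fun a : 'I_k.+1 => s (inord (j + a)) : nat).
  move=> a b /val_inj/perm_inj /(congr1 val) /=.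
  have [ak bk] := (ltn_ord a, ltn_ord b).
  by rewrite !inordK; [move=> /addnI /val_inj|lia|lia].
by exists p; apply/occP.
Qed.

(** Inside the window of an occurrence of [q] at [j], [s] and [q] order the positions alike;
    position [e] of [q] is position [j + e] of [s]. *)
Lemma occ_comp k K n (p : 'S_k.+1) (q : 'S_K.+1) (s : 'S_n.+1) e j :
  e + k <= K -> occ q s j -> occ p q e = occ p s (j + e).
Proof.
move=> ek /occP[jK Hq].
have E (a b : 'I_k.+1) : (q (inord (e + a)) <= q (inord (e + b))) =
  (s (inord (j + e + a)) <= s (inord (j + e + b))).
  have [ak bk] := (ltn_ord a, ltn_ord b).
  by rewrite Hq !inordK -?addnA //; lia.
apply/occP/occP => -[_ H]; split => //; try lia.
  by move=> a b; rewrite H E.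
by move=> a b; rewrite H E.
Qed.

Lemma occ1 n (s : 'S_n.+1) j : j <= n -> occ (1%g : 'S_1) s j.
Proof.
by move=> jn; apply/occP; split; rewrite ?addn0 // => a b; rewrite !ord1 !leqnn.
Qed.

(** Equality in the union of all the ['S_m] splits into an equality of sizes, along which positions
    are cast, and an equality of orders. *)
Lemma Tagged_patP m n (I : {set 'I_n}) (s : 'S_n) (p : 'S_m) :
  Tagged (fun m => 'S_m) (pat I s) = Tagged (fun m => 'S_m) p <->
  exists e : m = #|I|, forall a b,
   (p a <= p b) = (s (enum_val (cast_ord e a)) <= s (enum_val (cast_ord e b))).
Proof.
have patE a b : (pat I s a <= pat I s b) = (s (enum_val a) <= s (enum_val b)).
  rewrite /pat !permE /=.
  have [ab|ba|/val_inj/perm_inj/enum_val_inj->] := ltngtP (s (enum_val a)); last first.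
  - by rewrite leqnn.
  - by rewrite leqNgt pat_rank_mono.
  - by rewrite ltnW // pat_rank_mono.
split=> [E|[e H]].
  have e : #|I| = m by have := congr1 (@tag _ _) E.
  case: m / e p E => p /eqP; rewrite eq_Tagged /= => /eqP<-.
  by exists erefl => a b; rewrite !cast_ord_id patE.
have e' := esym e; case: m / e' p e H => p e H; congr Tagged.
by apply: perm_le_inj => a b; rewrite H !cast_ord_id patE.
Qed.

Definition window n j k : {set 'I_n.+1} := [set x : 'I_n.+1 | j <= x <= j + k].

Lemma enum_window n j k : j + k <= n ->
  map val (enum (window n j k)) = iota j k.+1.
Proof.
move=> jk; apply: (irr_sorted_eq ltn_trans ltnn) => //.
- have sub : subseq (enum (window n j k)) (enum 'I_n.+1).
    by rewrite [X in subseq _ X]enumT; exact: filter_subseq.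
  apply: (subseq_sorted ltn_trans (map_subseq val sub)).
  by rewrite val_enum_ord iota_ltn_sorted.
- exact: iota_ltn_sorted.
move=> x; rewrite mem_iota; apply/mapP/idP => [[y]|xjk].
  by rewrite mem_enum finset.inE => ? -> /=; lia.
have xn : x < n.+1 by lia.
by exists (Ordinal xn) => //; rewrite mem_enum finset.inE /=; lia.
Qed.

Lemma card_window n j k : j + k <= n -> #|window n j k| = k.+1.
Proof. by move=> jk; rewrite cardE -(size_map val) enum_window // size_iota. Qed.

Lemma enum_val_window n j k (a : 'I_#|window n j k|) : j + k <= n ->
  enum_val a = inord (j + a).
Proof.
move=> jk; apply: val_inj; rewrite /= (enum_val_nth ord0).
have ak : a < k.+1 by rewrite -(card_window jk).
rewrite -(nth_map _ (val (@ord0 n))) -?cardE //.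
rewrite [map _ _](enum_window jk) nth_iota // inordK //.
by apply: leq_ltn_trans (leq_trans _ jk) _; rewrite ?leq_add2l.
Qed.

Lemma int_interval_window n (I : {set 'I_n.+1}) k : is_int_interval I ->
  #|I| = k.+1 -> exists j : 'I_n.+1, j + k <= n /\ I = window n j k.
Proof.
move=> /forallP H cI.
have /set0Pn[x0 x0I] : I != finset.set0 by rewrite -card_gt0 cI.
(* An interval is the window from its minimum [j] to its maximum [l]. *)
pose j := [arg min_(x < x0 in I) (x : nat)].
pose l := [arg max_(x > x0 in I) (x : nat)].
have [jI jmin] : j \in I /\ forall x, x \in I -> j <= x.
  by rewrite /j; case: arg_minnP.
have [lI lmax] : l \in I /\ forall x, x \in I -> x <= l.
  by rewrite /l; case: arg_maxnP.
have jl : j <= l by exact: jmin.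
have E : I = window n j (l - j).
  apply/setP => x; rewrite finset.inE subnKC //; apply/idP/idP => [xI|jxl].
    by rewrite jmin // lmax.
  have /implyP/(_ jI)/forallP/(_ l)/implyP/(_ lI)/forallP/(_ x)/implyP := H j.
  by apply.
have jn : j + (l - j) <= n by have := ltn_ord l; lia.
have kE : l - j = k by apply/eqP; rewrite -eqSS -(card_window jn) -E cI.
by exists j; rewrite -kE.
Qed.

Lemma window_interval n j k : is_int_interval (window n j k).
Proof.
apply/forallP => x; apply/implyP; rewrite finset.inE => Hx; apply/forallP => y.
apply/implyP; rewrite finset.inE => Hy; apply/forallP => z; apply/implyP => Hz.
by rewrite finset.inE; lia.
Qed.

(** The intervals of size [k + 1] are the windows that fit in [[0, n]], and a window is determined
    by its start. *)
Lemma coccE k (p : 'S_k.+1) n (s : 'S_n.+1) :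
  cocc p s = #|[set j : 'I_n.+1 | occ p s j]|.
Proof.
have occ_window (j : 'I_n.+1) : j + k <= n ->
    (Tagged (fun m => 'S_m) (pat (window n j k) s) == Tagged (fun m => 'S_m) p)
    = occ p s j.
  move=> jk; apply/eqP/occP => [/Tagged_patP[e He]|[_ He]].
    by split => // a b; rewrite He !enum_val_window.
  apply/Tagged_patP; exists (esym (card_window jk)) => a b.
  by rewrite He !enum_val_window.
have inj : {in [set j : 'I_n.+1 | occ p s j] &,
    injective (fun j : 'I_n.+1 => window n j k)}.
  move=> x y; rewrite !finset.inE => /occP[xk _] /occP[yk _] /setP E.
  apply: val_inj; have := E x; have := E y; rewrite !finset.inE /=; lia.
rewrite -(card_in_imset inj) /cocc; congr #|pred_of_set _|.
apply/setP => I; rewrite !finset.inE; apply/andP/imsetP => [[iI tI]|[j]].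
  have e : #|I| = k.+1 by have /(congr1 (@tag _ _)) := eqP tI.
  have [j [jk E]] := int_interval_window iI e.
  by exists j; rewrite // finset.inE -(occ_window _ jk) -E.
rewrite finset.inE => oj ->; split; first exact: window_interval.
by rewrite occ_window //; case/occP: oj.
Qed.

Lemma cocc1 n (s : 'S_n.+1) : cocc (1%g : 'S_1) s = n.+1.
Proof.
rewrite coccE -[RHS]card_ord -cardsT; congr #|pred_of_set _|.
by apply/setP => j; rewrite !finset.inE occ1 // -ltnS.
Qed.

(* Extending the window of an occurrence of [p], [e] steps to the left and
   [K - k - e] to the right, is possible unless it leaves [0, n]. *)
Lemma cocc_extend k K (p : 'S_k.+1) e n (s : 'S_n.+1) : e + k <= K ->
  \sum_(q : 'S_K.+1 | occ p q e) cocc q s <= cocc p s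
    <= \sum_(q : 'S_K.+1 | occ p q e) cocc q s + K.
Proof.
move=> ek; pose A := [set j : 'I_n.+1 | (j + K <= n) && occ p s (j + e)].
(* Double counting: at each [j] with [j + K <= n] exactly one [q] of size [K + 1] occurs, and it
   contains [p] at [e] iff [p] occurs in [s] at [j + e]. *)
have sumE : \sum_(q : 'S_K.+1 | occ p q e) cocc q s = #|A|.
  transitivity (\sum_(q : 'S_K.+1 | occ p q e) \sum_(j : 'I_n.+1) occ q s j).
    apply: eq_bigr => q _; rewrite coccE -sum1dep_card big_mkcond.
    by apply: eq_bigr => j _; case: occ.
  rewrite exchange_big /= -sum1dep_card [RHS]big_mkcond /=.
  apply: eq_bigr => j _; have [jK|nK] /= := leqP (j + K) n; last first.
    by apply: big1 => q _; case: occP => // -[]; rewrite leqNgt nK.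
  have [q0 Hq0] := occ_exists s jK.
  rewrite -(occ_comp p ek Hq0) big_mkcond (bigD1 q0) //= Hq0.
  rewrite big1 ?addn0 // => q qq0; case: ifP => // _.
  by case: (boolP (occ q s j)) => // /occ_inj/(_ Hq0) E; rewrite E eqxx in qq0.
pose sh (j : 'I_n.+1) : 'I_n.+1 := inord (j + e).
have shE j : j \in A -> sh j = j + e :> nat.
  by rewrite finset.inE => /andP[jK _]; rewrite inordK //; lia.
have shinj : {in A &, injective sh}.
  move=> x y /shE xE /shE yE xy; apply: val_inj => /=.
  by move: (congr1 val xy); rewrite /= xE yE => /addIn.
(* The occurrences that are lost start in [C], where the extension leaves on the left, or in [D],
   where it leaves on the right; together they number at most [e + (K - e) = K]. *)
pose B := [set j : 'I_n.+1 | occ p s j]; pose C := [set j : 'I_n.+1 | j < e].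
pose D := [set j : 'I_n.+1 | n < j + (K - e)].
have AB : sh @: A \subset B.
  apply/fintype.subsetP => _ /imsetP[x xA ->]; move: (xA).
  by rewrite !finset.inE shE // => /andP[].
have BU : B \subset sh @: A :|: (C :|: D).
  apply/fintype.subsetP => x; rewrite !finset.inE => xB.
  have [//|ex] := ltnP x e; first by rewrite orbT.
  have [|xn] := ltnP n (x + (K - e)); first by rewrite !orbT.
  pose y := Ordinal (leq_ltn_trans (leq_subr e x) (ltn_ord x)).
  have yA : y \in A.
    by rewrite finset.inE /= subnK // xB andbT; lia.
  apply/orP; left; apply/imsetP; exists y => //.
  by apply: val_inj; rewrite /= shE //= subnK.
have cC : #|C| <= e.
  rewrite -[X in _ <= X](size_iota 0) cardE -(size_map val).
  apply: uniq_leq_size; first by rewrite map_inj_uniq ?enum_uniq //; exact: val_inj.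
  by move=> y /mapP[z]; rewrite mem_enum finset.inE mem_iota => ? ->.
have cD : #|D| <= K - e.
  rewrite -[X in _ <= X](size_iota (n.+1 - (K - e))) cardE -(size_map val).
  apply: uniq_leq_size; first by rewrite map_inj_uniq ?enum_uniq //; exact: val_inj.
  move=> y /mapP[z]; rewrite mem_enum finset.inE mem_iota => ? -> /=.
  by have := ltn_ord z; lia.
rewrite sumE coccE -/B -(card_in_imset shinj) subset_leq_card //=.
apply: leq_trans (subset_leq_card BU) _.
apply: leq_trans (leq_card_setU _ _) _; rewrite leq_add2l.
by apply: leq_trans (leq_card_setU _ _) _; lia.
Qed.

End Occurrences.

Local Open Scope classical_set_scope.

(** * Balls around the root, and the union of nested balls *)

Section Restrictions.

Lemma rdom_rooted_inord h (p : 'S_h.*2.+1) l :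
  rdom (rooted p (inord h)) l <-> - h%:Z <= l <= h%:Z.
Proof.
have hh : (h < h.*2.+1)%N by lia.
by rewrite /= /finite_dom /= inordK //; split; lia.
Qed.

Lemma rle_rooted_inord h (p : 'S_h.*2.+1) (a b : 'I_h.*2.+1) :
  rle (rooted p (inord h)) (a%:Z - h%:Z) (b%:Z - h%:Z) <-> (p a <= p b)%N.
Proof.
have hh : (h < h.*2.+1)%N by lia.
split=> [[a' [b' []]]|pab].
  rewrite inordK // !subrK => -[aa'] [bb'].
  by rewrite (val_inj aa') (val_inj bb').
by exists a, b; rewrite inordK // !subrK.
Qed.

Lemma restr_rootedP h (x : rooted_perm) (p : 'S_h.*2.+1) :
  restr h x = rooted p (inord h) <->
  (forall l, - h%:Z <= l <= h%:Z -> rdom x l) /\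
  (forall a b : 'I_h.*2.+1,
     rle x (a%:Z - h%:Z) (b%:Z - h%:Z) <-> (p a <= p b)%N).
Proof.
split=> [E|[dx lx]].
  split=> [l hl|a b].
    by have /(rdom_rooted_inord p) : - h%:Z <= l <= h%:Z by []; rewrite -E => -[].
  rewrite -rle_rooted_inord -E /=; split => [xab|[]//]; split => //.
    by have := ltn_ord a; lia.
  by have := ltn_ord b; lia.
have ordE (l : int) : - h%:Z <= l <= h%:Z -> exists a : 'I_h.*2.+1, l = a%:Z - h%:Z.
  move=> hl; have lt : (`|(l + h%:Z)%R| < h.*2.+1)%N by lia.
  by exists (Ordinal lt) => /=; lia.
apply: rooted_perm_eq.
  apply/seteqP; split=> l; first by case=> _ /= hl; exact/rdom_rooted_inord.
  by move=> /rdom_rooted_inord hl; split=> //; exact: dx.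
move=> l j; split=> [[lj hl hj]|].
  have [[a aE] [b bE]] := (ordE _ hl, ordE _ hj).
  by move: lj; rewrite aE bE => /lx ?; apply/rle_rooted_inord.
move=> lj; have [/rdom_rooted_inord hl /rdom_rooted_inord hj] :
    rdom (rooted p (inord h)) l /\ rdom (rooted p (inord h)) j.
  by case: (rooted_permP (rooted p (inord h))) => _ + _ _ _; exact.
split => //; have [[a aE] [b bE]] := (ordE _ hl, ordE _ hj).
by move: lj; rewrite aE bE => /rle_rooted_inord ?; apply/lx.
Qed.

(** The ball around [c] is the window that starts at [c - h]. Since this subtraction is truncated,
    [h <= c] has to be stated apart. *)
Lemma restr_finiteP h n (s : 'S_n.+1) (c : 'I_n.+1) (p : 'S_h.*2.+1) :
  restr h (rooted s c) = rooted p (inord h) <->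
  (h <= c)%N /\ occ p s (c - h).
Proof.
have cn := ltn_ord c.
rewrite restr_rootedP; split=> [[dx lx]|[hc /occP[hn Hp]]].
  have hc : (h <= c)%N.
    by have := dx (- h%:Z); rewrite /= /finite_dom /=; lia.
  have hn : (c - h + h.*2 <= n)%N.
    by have := dx h%:Z; rewrite /= /finite_dom /=; lia.
  split=> //; apply/occP; split=> // a b.
  have [ah bh] := (ltn_ord a, ltn_ord b).
  apply/idP/idP => [/lx[a' [b' [aE bE]]]|sab].
    have -> : inord (c - h + a) = a' by apply: val_inj; rewrite /= inordK; lia.
    by have -> : inord (c - h + b) = b' by apply: val_inj; rewrite /= inordK; lia.
  apply/lx; exists (inord (c - h + a)), (inord (c - h + b)).
  by split=> //; rewrite inordK; lia.
split=> [l|a b]; first by rewrite /= /finite_dom /=; lia.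
have [ah bh] := (ltn_ord a, ltn_ord b).
rewrite Hp; split=> [[a' [b' [aE bE]]]|sab].
  have -> : inord (c - h + a) = a' by apply: val_inj; rewrite /= inordK; lia.
  by have -> : inord (c - h + b) = b' by apply: val_inj; rewrite /= inordK; lia.
exists (inord (c - h + a)), (inord (c - h + b)).
by split=> //; rewrite inordK; lia.
Qed.

(** Occurrences are matched with their centres by a shift of [h]. There is no boundary error: a root
    too close to an end has a smaller ball and is counted on neither side. *)
Lemma cocc_restr h n (s : 'S_n.+1) (p : 'S_h.*2.+1) :
  cocc p s =
    (\sum_(c : 'I_n.+1) `[< restr h (rooted s c) = rooted p (inord h) >])%N.
Proof.
transitivity #|[set c : 'I_n.+1 | (h <= c)%N && occ p s (c - h)]%SET|; last first.
  rewrite -sum1dep_card big_mkcond; apply: eq_bigr => c _.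
  by congr (nat_of_bool _); apply/andP/asboolP => /restr_finiteP.
rewrite coccE.
pose sh (j : 'I_n.+1) : 'I_n.+1 := inord (j + h).
have shE (j : 'I_n.+1) : occ p s j -> sh j = (j + h)%N :> nat.
  by case/occP => jk _; rewrite inordK; lia.
have shinj : {in [set j : 'I_n.+1 | occ p s j]%SET &, injective sh}.
  move=> x y; rewrite !finset.inE => /shE xE /shE yE xy; apply: val_inj => /=.
  by move: (congr1 val xy); rewrite /= xE yE => /addIn.
rewrite -(card_in_imset shinj); congr #|pred_of_set _|.
apply/setP => c; rewrite finset.inE; apply/imsetP/andP => [[j]|[hc oc]].
  by rewrite finset.inE => oj ->; rewrite shE // leq_addl addnK.
pose j := Ordinal (leq_ltn_trans (leq_subr h c) (ltn_ord c)).
by exists j; rewrite ?finset.inE //; apply: val_inj; rewrite /= shE //= subnK.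
Qed.

Lemma rooted_union (z : nat -> rooted_perm) :
  (forall h l, rdom (z h) l <-> - h%:Z <= l <= h%:Z) ->
  (forall h, restr h (z h.+1) = z h) ->
  exists x, rdom x = setT /\ forall h, restr h x = z h.
Proof.
move=> zd zr.
have zrle h m l j : - h%:Z <= l <= h%:Z -> - h%:Z <= j <= h%:Z ->
    rle (z h) l j <-> rle (z (h + m)%N) l j.
  move=> hl hj; elim: m => [|m IH]; first by rewrite addn0.
  rewrite IH addnS -zr /=; split => [[]//|hlj]; split => //; lia.
have zrle' h h' l j : - h%:Z <= l <= h%:Z -> - h%:Z <= j <= h%:Z ->
    rle (z h') l j -> rle (z h) l j.
  move=> hl hj zlj; have [hh'|/ltnW h'h] := leqP h h'.
    by apply/(zrle h (h' - h)%N) => //; rewrite subnKC.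
  have [_ /(_ _ _ zlj)[/zd hl' /zd hj'] _ _ _] := rooted_permP (z h').
  have /zrle : - h'%:Z <= l <= h'%:Z by [].
  by move=> /(_ (h - h')%N j hj')[+ _]; rewrite subnKC //; exact.
(* The union of the orders. By [zrle] and [zrle'] every ball containing two points compares them
   alike, so each axiom can be checked in one ball large enough for the points involved. *)
pose le l j := exists h, rle (z h) l j.
have lez h l j : - h%:Z <= l <= h%:Z -> - h%:Z <= j <= h%:Z -> le l j -> rle (z h) l j.
  by move=> hl hj [h' /zrle']; apply.
have P : is_rooted setT le.
  split=> //.
  - move=> x y _ _; pose h := (`|x| + `|y|)%N.
    have [_ _ /(_ x y) tot _ _] := rooted_permP (z h).
    have [||H|H] := tot; [apply/zd; lia|apply/zd; lia|left|right]; by exists h.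
  - move=> x y xy yx; pose h := (`|x| + `|y|)%N.
    have [_ _ _ anti _] := rooted_permP (z h).
    by apply: anti; apply: lez => //; lia.
  - move=> x y t xy yt; pose h := (`|x| + `|y| + `|t|)%N; exists h.
    have [_ _ _ _ tr] := rooted_permP (z h).
    by apply: (tr _ y); apply: lez => //; lia.
exists (RootedPerm P); split => // h; apply: rooted_perm_eq => /=.
  by apply/seteqP; split => l; [case=> _ /zd | move=> /zd].
move=> l j; split => [[lj hl hj]|lj]; first exact: lez.
have [_ /(_ _ _ lj)[/zd hl /zd hj] _ _ _] := rooted_permP (z h).
by split => //; exists h.
Qed.

End Restrictions.

(** * Cylinders as a basis of neighbourhoods *)

Section Topology.
Variable R : realType.
Implicit Types x y : rooted_space R.

Lemma local_dist_lt x y h :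
  local_dist R x y < 2 `^ (- h%:R) -> restr h x = restr h y.
Proof.
rewrite /local_dist /pow2N; set u := agree_height R x y => uh.
have {uh} hu : ((h%:R)%:E < u)%E.
  move: uh; rewrite /u; have := agree_height_ge0 R x y.
  case: agree_height => [r| |] //; last by rewrite ltry.
  move=> _; rewrite lte_fin; apply: contraTT; rewrite -!leNgt => rh.
  by rewrite ler_powR ?ler1n // lerN2.
move: hu; rewrite /u /agree_height lt_max => /orP[|].
  by rewrite lte_fin ltrn0.
move=> /ereal_sup_gt[_ [k [_ kxy] <-]]; rewrite lte_fin ltr_nat => /ltnW hk.
exact: restr_eq_le kxy.
Qed.

(** Only positive radii enter [agree_set], whence the condition on [h]. *)
Lemma local_dist_le_restr x y h : (0 < h)%N ->
  restr h x = restr h y -> local_dist R x y <= 2 `^ (- h%:R).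
Proof.
move=> h0 hxy; rewrite -[leRHS]/(pow2N (h%:R)%:E); apply: pow2N_anti.
  by rewrite lee_fin.
rewrite /agree_height le_max; apply/orP; right.
by apply: ereal_sup_ubound; exists h.
Qed.

Lemma nbhs_restr x h : nbhs x [set y : rooted_space R | restr h x = restr h y].
Proof.
apply/nbhs_ballP; exists (2 `^ (- h%:R)) => /=; first by rewrite powR_gt0.
by move=> y; rewrite ballEmdist => /local_dist_lt.
Qed.

Lemma restr_nbhs x (U : set (rooted_space R)) : nbhs x U ->
  exists2 h, (0 < h)%N & forall y, restr h x = restr h y -> U y.
Proof.
move=> /nbhs_ballP[e /= e0 eU].
(* For an integer [h] above [1 / e] one has [2 ^ (- h) < 1 / h < e]. *)
exists (Num.bound e^-1) => [|y hxy].
  by rewrite -(ltr_nat R) (le_lt_trans _ (archi_boundP _)) ?invr_ge0 ?ltW.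
have b0 : (0 < Num.bound e^-1)%N.
  by rewrite -(ltr_nat R) (le_lt_trans _ (archi_boundP _)) ?invr_ge0 ?ltW.
apply: eU; rewrite ballEmdist /=.
apply: (le_lt_trans (local_dist_le_restr b0 hxy)).
rewrite powRN powR_mulrn ?ler0n // invf_plt ?posrE ?exprn_gt0 //.
apply: (lt_le_trans (archi_boundP _)); first by rewrite invr_ge0 ltW.
by rewrite -natrX ler_nat ltnW // ltn_expl.
Qed.

End Topology.

(** * Real limits and random variables with finitely many values *)

Lemma cvg_EFinP (R : realType) (u : nat -> R) (a : R) :
  (fun n => (u n)%:E) @ \oo --> a%:E <-> u @ \oo --> a.
Proof.
rewrite (fine_cvgP (fun n => (u n)%:E)); split=> [[_]//|ua]; split => //.
exact: nearW.
Qed.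

Section FiniteRV.
Context (R : realType) (d : measure_display) (T : measurableType d).
Variable P : probability T R.

(** [g (Y w)] is the sum over [v] of [g v] times the indicator of the fibre of [v]. Measurability is
    asked of the fibres, so that [V] carries no sigma-algebra. *)
Lemma expectation_fintype (V : finType) (Y : T -> V) (g : V -> R) :
  (forall v, measurable (Y @^-1` [set v])) ->
  'E_P[fun w => g (Y w)]%E =
    (\sum_v g v * fine (P (Y @^-1` [set v])))%:E.
Proof.
move=> mY; rewrite unlock.
have intg v : P.-integrable setT (fun w => ((g v)%:E * (\1_(Y @^-1` [set v]) w)%:E)%E).
  apply: integrableZl => //; exact: integrable_indic.
transitivity (\int[P]_w (\sum_v ((g v)%:E * (\1_(Y @^-1` [set v]) w)%:E)))%E.
  apply: eq_integral => w _; rewrite (bigD1 (Y w)) //= big1 => [|v vY].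
    by rewrite indicE mem_set //= mule1 adde0.
  by rewrite indicE memNset ?mule0 //= => /esym/eqP; rewrite (negbTE vY).
rewrite integral_sum // -sumEFin; apply: eq_bigr => v _.
rewrite integralZl //; last exact: integrable_indic.
by rewrite integral_indic // setIT EFinM fineK // fin_num_measure.
Qed.

Lemma probability_fintype (V : finType) (Y : T -> V) (A : pred V) :
  (forall v, measurable (Y @^-1` [set v])) ->
  P [set w | A (Y w)] = (\sum_(v | A v) fine (P (Y @^-1` [set v])))%:E.
Proof.
move=> mY; have mA : measurable [set w | A (Y w)].
  have -> : [set w | A (Y w)] = \bigcup_(v in [set v | A v]) Y @^-1` [set v].
    by apply/seteqP; split => [w /= AY|w [v /= Av ->]]; first by exists (Y w).
  by apply: fin_bigcup_measurable => //; exact: finite_finset.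
rewrite -(expectation_indic P mA) big_mkcond /=.
transitivity ('E_P[fun w => (A (Y w))%:R])%E.
  congr expectation.body; apply/funext => w; rewrite indicE.
  by case: (boolP (A (Y w))) => AY; [rewrite mem_set|rewrite memNset //; exact/negP].
rewrite (expectation_fintype (fun v => (A v)%:R) mY); congr EFin.
by apply: eq_bigr => v _; case: (A v); rewrite ?mul1r ?mul0r.
Qed.

End FiniteRV.

(** * Mean pattern proportions and ball probabilities *)

Section MeanOccurrences.
Context (R : realType) (d : measure_display) (T : measurableType d).
Variables (P : probability T R) (n : nat) (sigma : {RV P >-> 'S_n.+1}).

Lemma measurable_preimage_RV d' (T' : measurableType d') (X : {RV P >-> T'})
  (A : set T') : measurable A -> measurable (X @^-1` A).
Proof.
by move=> mA; rewrite -[X in measurable X]setTI; exact: measurable_funPT.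
Qed.

(** The expected proportion as a finite real sum, so that limits are taken in [R] and not in the
    extended reals. *)
Definition mean_cocc k (p : 'S_k.+1) : R :=
  \sum_s cocc_prop R p s * fine (P (sigma @^-1` [set s])).

Lemma mean_coccE k (p : 'S_k.+1) :
  'E_P[fun w => cocc_prop R p (sigma w)]%E = (mean_cocc p)%:E.
Proof.
rewrite (expectation_fintype P (@cocc_prop R _ p n.+1)) // => s.
exact: measurable_preimage_RV.
Qed.

Let mass_ge0 s : 0 <= fine (P (sigma @^-1` [set s])).
Proof. exact: fine_ge0. Qed.

Let mass_sum : \sum_s fine (P (sigma @^-1` [set s])) = 1.
Proof.
have := @probability_fintype _ _ _ P _ sigma xpredT
  (fun s => measurable_preimage_RV sigma (I : measurable [set s])).
rewrite (_ : [set w | _] = setT) ?probability_setT; last by apply/seteqP.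
by case.
Qed.

Lemma mean_cocc1 : mean_cocc (1%g : 'S_1) = 1.
Proof.
rewrite -mass_sum; apply: eq_bigr => s _.
by rewrite /cocc_prop cocc1 divff ?mul1r.
Qed.

(** Average of [cocc_extend] over the law of [sigma]; the masses sum to 1, so the error stays
    [K / (n + 1)]. *)
Lemma mean_cocc_extend k K (p : 'S_k.+1) e : (e + k <= K)%N ->
  \sum_(q : 'S_K.+1 | occ p q e) mean_cocc q <= mean_cocc p
    <= \sum_(q : 'S_K.+1 | occ p q e) mean_cocc q + K%:R / n.+1%:R.
Proof.
move=> ek; rewrite /mean_cocc exchange_big /=.
have E s : (\sum_(q : 'S_K.+1 | occ p q e) cocc_prop R q s *
    fine (P (sigma @^-1` [set s]))) =
    (\sum_(q : 'S_K.+1 | occ p q e) cocc q s)%:R / n.+1%:R *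
    fine (P (sigma @^-1` [set s])).
  by rewrite -mulr_suml natr_sum -mulr_suml.
under eq_bigr do rewrite E.
have -> : K%:R / n.+1%:R =
    \sum_s K%:R / n.+1%:R * fine (P (sigma @^-1` [set s])) :> R.
  by rewrite -mulr_sumr mass_sum mulr1.
rewrite -big_split /=.
have n0 : 0 <= n.+1%:R^-1 :> R by rewrite invr_ge0.
apply/andP; split; apply: ler_sum => s _; have /andP[lo hi] := cocc_extend p s ek.
  apply: ler_wpM2r; first exact: mass_ge0.
  by apply: ler_wpM2r => //; rewrite ler_nat.
rewrite -mulrDl -mulrDl -natrD.
apply: ler_wpM2r; first exact: mass_ge0.
by apply: ler_wpM2r => //; rewrite ler_nat.
Qed.

Variables (i : {RV P >-> 'I_n.+1}) (i_uniform : uniform_index i)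
  (i_indep : independent_RV sigma i).

Let si w := (sigma w, i w).

Let msi v : measurable (si @^-1` [set v]).
Proof.
rewrite (_ : _ @^-1` _ = sigma @^-1` [set v.1] `&` i @^-1` [set v.2]); last first.
  by apply/seteqP; split => w; case: v => a b; rewrite /si /=; [case|case=> -> ->].
by apply: measurableI; exact: measurable_preimage_RV.
Qed.

Let massE v : fine (P (si @^-1` [set v])) =
  fine (P (sigma @^-1` [set v.1])) / n.+1%:R.
Proof.
rewrite (_ : _ @^-1` _ = sigma @^-1` [set v.1] `&` i @^-1` [set v.2]); last first.
  by apply/seteqP; split => w; case: v => a b; rewrite /si /=; [case|case=> -> ->].
by rewrite i_indep // i_uniform fineM // fin_num_measure //; exact: measurable_preimage_RV.
Qed.

(** Given [sigma = s], the independent uniform root is the centre of an occurrence of [p] with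
    probability [cocc p s / (n + 1)]. *)
Lemma ball_prob h (p : 'S_h.*2.+1) :
  P [set w | restr h (rooted (sigma w) (i w)) = rooted p (inord h)] =
  (mean_cocc p)%:E.
Proof.
pose A (v : 'S_n.+1 * 'I_n.+1) := `[< restr h (rooted v.1 v.2) = rooted p (inord h) >].
rewrite (_ : [set w | _] = [set w | A (si w)]); last first.
  by apply/seteqP; split => w /asboolP.
rewrite (probability_fintype P A msi); congr EFin.
transitivity (\sum_s \sum_c
    if A (s, c) then fine (P (si @^-1` [set (s, c)])) else 0).
  by rewrite big_mkcond pair_bigA; apply: eq_bigr => -[].
apply: eq_bigr => s _; rewrite /cocc_prop cocc_restr natr_sum mulr_suml mulr_suml.
apply: eq_bigr => c _; rewrite massE /= /A /=.
by case: asboolP; rewrite ?mul0r // mul1r mulrC.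
Qed.

(** Pointwise, [f] is at least [- M] plus the sum over [p] of [m p + M] times the indicator that the
    ball is [p]. The shift by [M] covers the roots whose ball is cut off by an end. *)
Lemma rooted_RV_expectation_ge (f : rooted_space R -> R) (M : R) h
    (m : 'S_h.*2.+1 -> R) :
  (forall x, - M <= f x) ->
  (forall p (x : rooted_space R), restr h x = rooted p (inord h) -> m p <= f x) ->
  exists2 e, 'E_P[f \o rooted_RV sigma i]%E = e%:E &
    - M + \sum_p (m p + M) * mean_cocc p <= e.
Proof.
move=> fM mf.
exists (\sum_v f (rooted v.1 v.2) * fine (P (si @^-1` [set v]))).
  by rewrite -(expectation_fintype P (fun v => f (rooted v.1 v.2)) msi).
have sum1 : \sum_v fine (P (si @^-1` [set v])) = 1.
  have := probability_fintype P xpredT msi.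
  rewrite (_ : [set w | _] = setT) ?probability_setT; last by apply/seteqP.
  by case.
have mE (p : 'S_h.*2.+1) : mean_cocc p =
    \sum_v `[< restr h (rooted v.1 v.2) = rooted p (inord h) >]%:R *
    fine (P (si @^-1` [set v])).
  have := ball_prob p.
  pose A (v : 'S_n.+1 * 'I_n.+1) := `[< restr h (rooted v.1 v.2) = rooted p (inord h) >].
  rewrite (_ : [set w | _] = [set w | A (si w)]); last first.
    by apply/seteqP; split => w /asboolP.
  rewrite (probability_fintype P A msi) => -[<-]; rewrite big_mkcond /=.
  by apply: eq_bigr => v _; rewrite /A; case: asboolP; rewrite ?mul0r ?mul1r.
have -> : - M = \sum_v - M * fine (P (si @^-1` [set v])).
  by rewrite -mulr_sumr sum1 mulr1.
under [X in _ + X]eq_bigr do rewrite mE mulr_sumr.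
rewrite exchange_big -big_split /=; apply: ler_sum => v _.
under eq_bigr do rewrite mulrA.
rewrite -mulr_suml -mulrDl ler_wpM2r ?fine_ge0 //.
have [[p Hp]|nH] := pselect (exists p : 'S_h.*2.+1,
    restr h (rooted v.1 v.2) = rooted p (inord h)).
  rewrite (bigD1 p) //= asboolT // mulr1 big1 ?addr0 => [|q qp].
    by rewrite addrC addrK mf.
  rewrite asboolF ?mulr0 // => Hq; move/eqP: qp; apply.
  apply: perm_le_inj => a b; apply/idP/idP.
    by move=> /rle_rooted_inord; rewrite -Hq Hp => /rle_rooted_inord.
  by move=> /rle_rooted_inord; rewrite -Hp Hq => /rle_rooted_inord.
(* The root is less than [h] steps from an end: the sum vanishes and only [- M] is left. *)
rewrite big1 ?addr0 // => p _; rewrite asboolF ?mulr0 // => Hp.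
by apply: nH; exists p.
Qed.

End MeanOccurrences.

(** * Intervals of prescribed lengths laid side by side *)

Section Subdivision.
Context (R : realType) (V : finType) (G : V -> R) (G0 : forall v, 0 <= G v).

(** The left end of the interval of [v] when intervals of lengths [G] are placed from 0 on, in the
    order of [enum_rank]. *)
Definition offset (v : V) : R := \sum_(u : V | (enum_rank u < enum_rank v)%N) G u.

Lemma offset_ge0 v : 0 <= offset v.
Proof. exact: sumr_ge0. Qed.

Let partial k : R := \sum_(u : V | (enum_rank u < k)%N) G u.

Let partialS v : partial (enum_rank v).+1 = offset v + G v.
Proof.
rewrite /partial (bigD1 v) //= addrC; congr (_ + _); apply: eq_bigl => u.
rewrite ltnS ltn_neqAle andbC; congr (_ && _).
by rewrite (inj_eq val_inj) (inj_eq enum_rank_inj).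
Qed.

Let partial_le k l : (k <= l)%N -> partial k <= partial l.
Proof.
move=> kl; rewrite /partial [leLHS]big_mkcond [leRHS]big_mkcond.
apply: ler_sum => u _; have [uk|_] := ltnP (enum_rank u) k.
  by rewrite (leq_trans uk kl).
by case: ifP.
Qed.

Lemma offset_le v : offset v + G v <= \sum_u G u.
Proof.
rewrite -partialS (le_trans (partial_le (ltn_ord _))) // /partial.
by under eq_bigl do rewrite ltn_ord.
Qed.

Lemma offset_inj u v w : offset u <= w < offset u + G u ->
  offset v <= w < offset v + G v -> u = v.
Proof.
wlog uv : u v / (enum_rank u <= enum_rank v)%N.
  have [uv H /H|/ltnW vu H wu wv] := leqP (enum_rank u) (enum_rank v); first exact.
  by apply/esym; exact: H.
move=> /andP[_ wu] /andP[vw _]; apply: enum_rank_inj; apply: val_inj.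
apply/eqP; rewrite eqn_leq uv /= leqNgt; apply/negP => /partial_le.
rewrite partialS -/(offset v) => H.
by have := lt_le_trans wu (le_trans H vw); rewrite ltxx.
Qed.

Lemma offset_exists w : 0 <= w < \sum_u G u ->
  exists v, offset v <= w < offset v + G v.
Proof.
move=> /andP[w0 wG]; apply: contrapT => nv.
(* If no interval contains [w], then [w] passes the right end of each in turn, hence also the total
   length. *)
have H k : (k <= #|V|)%N -> partial k <= w.
  elim: k => [_|k IH kV]; first by rewrite /partial big_pred0.
  pose v := enum_val (Ordinal kV).
  have kE : enum_rank v = k :> nat by rewrite enum_valK.
  rewrite -kE partialS leNgt; apply/negP => wv.
  by apply: nv; exists v; rewrite wv andbT /offset kE IH // ltnW.
have := H _ (leqnn _); rewrite leNgt => /negP; apply.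
by rewrite /partial; under eq_bigl do rewrite ltn_ord.
Qed.

End Subdivision.

(** * The uniform law of an interval *)

Section UniformInterval.
Variable R : realType.

Lemma uniform_prob_itv (a b : R) : 0 <= a -> a <= b -> b <= 1 ->
  uniform_prob (@ltr01 R) `[a, b[ = (b - a)%:E.
Proof.
move=> a0 ab b1; rewrite /uniform_prob integral_uniform_pdf.
rewrite setIidl; last first.
  by move=> x /=; rewrite !in_itv /= => /andP[ax xb]; lra.
rewrite (eq_integral (fun=> 1%E)); last first.
  move=> x; rewrite inE /= in_itv /= /uniform_pdf => /andP[ax xb].
  by rewrite ifT ?subr0 ?invr1 //; lra.
rewrite integral_cst //= mul1e lebesgue_measure_itv /= lte_fin.
move: ab; rewrite le_eqVlt => /orP[/eqP->|->]; last by rewrite EFinB.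
by rewrite ltxx subrr.
Qed.

End UniformInterval.

(* A point [w] of [0, 1[ is followed down the tree of the [V h]: each vertex is
   given a half-open interval of length [G h v], and the intervals of its
   children subdivide it. *)
Section ConsistentFamily.
Context (R : realType) (V : nat -> finType) (rho : forall h, V h.+1 -> V h).
Variable G : forall h, V h -> R.
Hypothesis G0 : forall h (v : V h), 0 <= G v.
Hypothesis G_total : \sum_(v : V 0%N) G v = 1.
Hypothesis G_consistent :
  forall h (v : V h), G v = \sum_(u | rho u == v) G u.

(** The weights of the children of [v], extended by 0 to the whole level: [offset] then applies to
    [V h.+1], and a vertex that is no child of [v] gets an empty interval. *)
Let sib h (v : V h) u := if rho u == v then G u else 0.

Let sib0 h (v : V h) u : 0 <= sib v u.
Proof. by rewrite /sib; case: ifP. Qed.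

Let sib_total h (v : V h) : \sum_u sib v u = G v.
Proof. by rewrite G_consistent [RHS]big_mkcond. Qed.

Fixpoint left_end h : V h -> R :=
  if h is h'.+1 then fun u => left_end (rho u) + offset (sib (rho u)) u
  else offset (@G 0%N).

Let cell h (v : V h) w := left_end v <= w < left_end v + G v.

Let cell_parent h (u : V h.+1) w : cell u w -> cell (rho u) w.
Proof.
rewrite /cell /= => /andP[uw wu].
have := offset_ge0 (sib0 (rho u)) u.
have := offset_le (sib0 (rho u)) u.
by rewrite sib_total /sib eqxx; lra.
Qed.

Let cell_sub h (v : V h) : 0 <= left_end v /\ left_end v + G v <= 1.
Proof.
elim: h v => [|h IH] v /=.
  by rewrite offset_ge0 // -G_total offset_le.
have [] := IH (rho v).
have := offset_ge0 (sib0 (rho v)) v.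
have := offset_le (sib0 (rho v)) v.
by rewrite sib_total /sib eqxx => ? ? ? ?; split; lra.
Qed.

Let cell_inj h (u v : V h) w : cell u w -> cell v w -> u = v.
Proof.
elim: h u v => [|h IH] u v; first exact: offset_inj.
move=> uw vw; have E := IH _ _ (cell_parent uw) (cell_parent vw).
move: uw vw; rewrite /cell /= E => /andP[u1 u2] /andP[v1 v2].
have sibv : sib (rho v) v = G v by rewrite /sib eqxx.
have sibu : sib (rho v) u = G u by rewrite /sib E eqxx.
apply: (@offset_inj _ _ _ (sib0 (rho v)) u v (w - left_end (rho v))).
  by rewrite sibu; apply/andP; split; lra.
by rewrite sibv; apply/andP; split; lra.
Qed.

Let cell_exists h w : 0 <= w < 1 -> exists v : V h, cell v w.
Proof.
move=> w01; elim: h => [|h [v /andP[vw wv]]].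
  by by apply: offset_exists; rewrite G_total.
have /offset_exists[u] : 0 <= w - left_end v < \sum_u sib v u.
  by rewrite sib_total; apply/andP; split; lra.
(* The interval of [u] contains a point, so it is not empty and [u] is a child of [v]. *)
rewrite [X in _ < _ + X]/sib; case: eqP => [E|_]; last by rewrite addr0 => /andP[]; lra.
move=> /andP[u1 u2]; exists u; rewrite /cell /= E; apply/andP; split; lra.
Qed.

Lemma consistent_family_RV :
  exists Y : forall h, measurableTypeR R -> V h,
    (forall h w, rho (Y h.+1 w) = Y h w) /\
    (forall h (v : V h), measurable (Y h @^-1` [set v]) /\
       uniform_prob (@ltr01 R) (Y h @^-1` [set v]) = (G v)%:E).
Proof.
(* The sample space is the whole line. Points outside [[0, 1[], a null set, are treated as 0, so
   that every [Y h] is total. *)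
pose clamp (w : R) := if 0 <= w < 1 then w else 0.
have clamp01 w : 0 <= clamp w < 1.
  by rewrite /clamp; case: ifP => // _; rewrite lexx ltr01.
have /choice[y Hy] : forall w, exists y : forall h, V h, forall h, cell (y h) (clamp w).
  move=> w; have H h : {v : V h | cell v (clamp w)} by apply: cid; exact: cell_exists.
  by exists (fun h => sval (H h)) => h; exact: svalP (H h).
exists (fun h w => y w h); split => [h w|h v].
  by apply: (@cell_inj h _ _ (clamp w)) => //; exact: cell_parent.
(* The fibre of [v] is its interval, together with the null set outside [[0, 1[] when the interval
   contains 0. *)
have E : (fun w => y w h) @^-1` [set v] =
    `[left_end v, left_end v + G v[ `|` [set w | cell v 0 /\ ~ 0 <= w < 1].
  apply/seteqP; split => w /=.
    move=> yv; have := Hy w h; rewrite yv /clamp; case: ifP => w01 c; last by right.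
    by left; rewrite in_itv.
  move=> wv; apply: (@cell_inj h _ _ (clamp w)) => //.
  case: wv => [|[c /negP/negbTE w01]]; last by rewrite /clamp w01.
  rewrite in_itv /= => /andP[w1 w2]; have [l0 l1] := cell_sub v.
  rewrite /clamp ifT; first by rewrite /cell w1 w2.
  by apply/andP; split; lra.
have [l0 l1] := cell_sub v.
have mI : measurable (`[left_end v, left_end v + G v[ : set (measurableTypeR R)).
  exact: measurable_itv.
have outE : ~` `[0, 1[ = [set w : R | ~ 0 <= w < 1].
  by apply/seteqP; split => w /=; rewrite in_itv.
have m01 : measurable (`[0, 1[ : set (measurableTypeR R)) by exact: measurable_itv.
have out0 : uniform_prob (@ltr01 R) (~` `[0, 1[) = 0%E.
  rewrite probability_setC // [X in (_ - X)%E](_ : _ = 1%:E) ?subee //.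
  by rewrite -[in RHS](subr0 1); apply: uniform_prob_itv.
have PI : uniform_prob (@ltr01 R) `[left_end v, left_end v + G v[ = (G v)%:E.
  by rewrite uniform_prob_itv ?lerDl // addrC addKr.
rewrite E; have [c0|nc0] := pselect (cell v 0).
  rewrite (_ : [set w : R | _ /\ _] = ~` `[0, 1[); last first.
    by rewrite outE; apply/seteqP; split => w /=; [case|].
  have mC : measurable (~` `[0, 1[ : set (measurableTypeR R)) by exact: measurableC.
  split; first exact: measurableU.
  by rewrite measureU0.
rewrite (_ : [set w : R | _ /\ _] = set0) ?setU0 //.
by apply/seteqP; split => w //= [].
Qed.

End ConsistentFamily.

Lemma cvg_fin_sum (R : realType) (I : finType) (A : pred I) (u : nat -> I -> R)
    (l : I -> R) :
  (forall i, (fun n => u n i) @ \oo --> l i) ->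
  (fun n => \sum_(i | A i) u n i) @ \oo --> \sum_(i | A i) l i.
Proof. by move=> ul; apply: cvg_big => //; exact: add_continuous. Qed.

Lemma cvg_const_div (R : realType) (c : R) : (fun n => c / n.+1%:R) @ \oo --> (0 : R).
Proof.
rewrite -[X in _ --> X](mulr0 c); apply: cvgM; first exact: cvg_cst.
exact: cvg_harmonic.
Qed.

(** * Continuous functions on the space of rooted permutations *)

Section ContinuousFunctions.
Variable R : realType.

Lemma continuous_restr (f : rooted_space R -> R) h :
  (forall x y : rooted_space R, restr h x = restr h y -> f x = f y) -> continuous f.
Proof.
move=> fh x; apply: (@cvg_near_cst _ _ (f x) f (nbhs x) (nbhs_filter x)).
move: (nbhs_restr x h); apply: filterS => y /= xy.
by rewrite (fh x y xy).
Qed.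

Lemma measurable_open (U : set (rooted_space R)) : open U -> measurable U.
Proof. exact: sub_sigma_algebra. Qed.

Lemma open_restr h (z : rooted_perm) : open [set x : rooted_space R | restr h x = z].
Proof.
rewrite openE => x /= <-; move: (nbhs_restr x h); apply: filterS => y /= xy.
by rewrite xy.
Qed.

Lemma measurable_continuous (f : rooted_space R -> R) :
  continuous f -> measurable_fun setT f.
Proof.
move=> /continuousP cf.
apply: (measurability _ (measurable_realfun.RGenOpens.measurableE R)).
move=> _ [_ [a [b ->] <-]]; rewrite setTI.
by apply: measurable_open; exact/cf/interval_open.
Qed.

Context (d : measure_display) (T : measurableType d) (P : probability T R).
Variables (X : {RV P >-> rooted_space R}) (f : rooted_space R -> R) (M : R).
Hypotheses (cf : continuous f) (fM : forall x, `|f x| <= M).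

Lemma integrable_continuous : P.-integrable setT (fun w => (f (X w))%:E).
Proof.
apply: (@measurable_bounded_integrable _ _ _ P (f \o X)) => //.
- by rewrite -ge0_fin_numE // fin_num_measure.
- apply: measurableT_comp => //; exact: measurable_continuous.
exists M; split; first exact: num_real.
by move=> y My w _ /=; exact: le_trans (fM _) (ltW My).
Qed.

(** Turns the lower bound obtained for [- f] into an upper bound for [f]. *)
Lemma expectation_continuousN :
  'E_P[(fun x => (- f x)%R) \o X]%E = (- 'E_P[f \o X])%E.
Proof.
rewrite unlock -mulN1e -integralZl //; last exact: integrable_continuous.
by apply: eq_integral => w _; rewrite /= mulN1e.
Qed.

End ContinuousFunctions.

(** * Passage to the limit between balls, patterns and the random order *)

Section Limits.
Context (R : realType) (d : nat -> measure_display)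
  (T : forall n, measurableType (d n)) (P : forall n, probability (T n) R)
  (sigma : forall n, {RV (P n) >-> 'S_n.+1})
  (i : forall n, {RV (P n) >-> 'I_n.+1})
  (i_uniform : forall n, uniform_index (i n))
  (i_indep : forall n, independent_RV (sigma n) (i n)).

Local Notation mean n p := (mean_cocc (sigma n) p).

Lemma cocc_limitE Delta : cocc_limit sigma Delta <->
  forall k (p : 'S_k.+1), 0 <= Delta k p /\ (fun n => mean n p) @ \oo --> Delta k p.
Proof.
rewrite /cocc_limit; split=> H k p; have [D0] := H k p.
  rewrite (_ : (fun n => 'E_(P n)[_]%E) = (fun n => (mean n p)%:E)).
    by move=> /cvg_EFinP.
  by apply/funext => n; rewrite mean_coccE.
rewrite (_ : (fun n => 'E_(P n)[_]%E) = (fun n => (mean n p)%:E)).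
  by move=> Dp; split => //; apply/cvg_EFinP.
by apply/funext => n; rewrite mean_coccE.
Qed.

(** By [ball_prob] the ball probabilities are the mean proportions, so this is [cocc_limitE] at the
    single size [2h + 1]. *)
Lemma ball_limitE h (Gamma : 'S_h.*2.+1 -> R) : ball_limit sigma i Gamma <->
  forall p, 0 <= Gamma p /\ (fun n => mean n p) @ \oo --> Gamma p.
Proof.
rewrite /ball_limit; split=> H p; have [D0] := H p.
  rewrite (_ : (fun n => P n _) = (fun n => (mean n p)%:E)).
    by move=> /cvg_EFinP.
  by apply/funext => n; rewrite ball_prob.
rewrite (_ : (fun n => P n _) = (fun n => (mean n p)%:E)).
  by move=> Dp; split => //; apply/cvg_EFinP.
by apply/funext => n; rewrite ball_prob.
Qed.

Lemma mean_cocc_cvg_extend k K (p : 'S_k.+1) e (Delta : 'S_K.+1 -> R) :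
  (e + k <= K)%N ->
  (forall q, (fun n => mean n q) @ \oo --> Delta q) ->
  (fun n => mean n p) @ \oo --> \sum_(q | occ p q e) Delta q.
Proof.
move=> ek HD.
have S := @cvg_fin_sum _ _ (fun q => occ p q e) _ _ HD.
apply: (squeeze_cvgr (f := fun n => \sum_(q : 'S_K.+1 | occ p q e) mean n q)
  (h := fun n => \sum_(q : 'S_K.+1 | occ p q e) mean n q + K%:R / n.+1%:R)) => //.
  by apply: nearW => n; exact: mean_cocc_extend.
rewrite -[X in _ --> X]addr0; apply: cvgD => //; exact: cvg_const_div.
Qed.

Lemma ball_limit_cocc :
  (forall h : nat, (0 < h)%N ->
     exists Gamma : 'S_h.*2.+1 -> R, ball_limit sigma i Gamma) ->
  exists Delta : forall k, 'S_k.+1 -> R, cocc_limit sigma Delta.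
Proof.
move=> H.
(* A pattern of size [k + 1] is extended to the right into a ball of radius [k + 1]; this radius is
   positive even for [k = 0]. *)
have G k : {Gamma : 'S_k.+1.*2.+1 -> R | ball_limit sigma i Gamma}.
  by apply: cid; exact: H.
exists (fun k p => \sum_(q | occ p q 0) sval (G k) q).
apply/cocc_limitE => k p; have /ball_limitE GP := svalP (G k).
split; first by apply: sumr_ge0 => q _; case: (GP q).
apply: mean_cocc_cvg_extend => [|q]; first by lia.
by case: (GP q).
Qed.

(** Whether the ball of radius [h] is [p] depends on that ball alone, so the indicator of the
    cylinder is a bounded continuous test function. *)
Lemma BS_limit_ball (d' : measure_display) (T' : measurableType d')
    (P' : probability T' R) (X : {RV P' >-> rooted_space R}) h (p : 'S_h.*2.+1) :
  BS_limit sigma i X ->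
  (fun n => mean n p) @ \oo -->
    fine (P' [set w | restr h (X w) = rooted p (inord h)]).
Proof.
move=> [_ cvgX]; pose B := [set x : rooted_space R | restr h x = rooted p (inord h)].
have mB : measurable B by apply: measurable_open; exact: open_restr.
have := cvgX (\1_B : rooted_space R -> R).
have -> : ('E_P'[\1_B \o X] = (fine (P' (X @^-1` B)))%:E)%E.
  rewrite fineK ?fin_num_measure //; last exact: measurable_preimage_RV.
  by rewrite -(expectation_indic P' (measurable_preimage_RV X mB)).
have -> : (fun n => 'E_(P n)[\1_B \o rooted_RV (sigma n) (i n)])%E =
    (fun n => (mean n p)%:E).
  apply/funext => n; rewrite -(ball_prob (@i_uniform n) (@i_indep n)).
  have mXB := measurable_preimage_RV (rooted_RV (sigma n) (i n)) mB.
  by rewrite -(expectation_indic (P n) mXB).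
move=> H; apply/cvg_EFinP; apply: H.
  apply: (@continuous_restr _ _ h) => x y xy; rewrite !indicE.
  congr (nat_of_bool _)%:R; apply/idP/idP => /set_mem /= E; apply: mem_set; rewrite /B /=.
    by rewrite -xy.
  by rewrite xy.
by exists 1 => x; rewrite indicE; case: (_ \in _); rewrite ?normr1 ?normr0.
Qed.

(** * Construction of the limiting random order *)

Section Construction.
Variables (Delta : forall k, 'S_k.+1 -> R) (HDelta : cocc_limit sigma Delta).

Let Delta_ge0 k p : 0 <= @Delta k p.
Proof. by have /cocc_limitE/(_ k p)[] := HDelta. Qed.

Let Delta_cvg k p : (fun n => mean n p) @ \oo --> @Delta k p.
Proof. by have /cocc_limitE/(_ k p)[] := HDelta. Qed.

(** Both sides are limits of the same sequence, the boundary error being [O(1/n)]. *)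
Lemma cocc_limit_extend k K (p : 'S_k.+1) e : (e + k <= K)%N ->
  Delta p = \sum_(q : 'S_K.+1 | occ p q e) Delta q.
Proof.
move=> ek; have := @mean_cocc_cvg_extend _ _ p _ _ ek (fun q => @Delta_cvg _ q).
by apply: cvg_unique => //; exact: Delta_cvg.
Qed.

Lemma cocc_limit_total K : \sum_(q : 'S_K.+1) Delta q = 1.
Proof.
transitivity (Delta (1%g : 'S_1)).
  by rewrite (@cocc_limit_extend _ K _ 0) //; apply: eq_bigl => q; rewrite occ1.
have := @Delta_cvg 0 1%g; under eq_fun do rewrite mean_cocc1.
by move=> H; apply: (cvg_unique _ H) => //; exact: cvg_cst.
Qed.

(** The parent of a pattern of size [2h + 3] is its central pattern of size [2h + 1], which starts
    at position 1. *)
Let rho h (q : 'S_h.+1.*2.+1) : 'S_h.*2.+1 :=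
  sval (cid (@occ_exists h.*2 h.+1.*2 q 1 (leqnSn _))).

Let rhoP h (q : 'S_h.+1.*2.+1) p : (rho q == p) = occ p q 1.
Proof.
rewrite /rho; case: cid => p0 /= Hp0; apply/eqP/idP => [<-//|].
exact: occ_inj.
Qed.

Let T' := measurableTypeR R.
Let P' : probability T' R := uniform_prob (@ltr01 R).

Lemma limit_exists : exists (Y : forall h, T' -> 'S_h.*2.+1)
    (X : {RV P' >-> rooted_space R}),
  (forall h p, measurable (Y h @^-1` [set p]) /\ P' (Y h @^-1` [set p]) = (Delta p)%:E) /\
  (forall w, rooted_infinite (X w) /\
     forall h, restr h (X w) = rooted (Y h w) (inord h)).
Proof.
have [] := @consistent_family_RV R (fun h => 'S_h.*2.+1) rho (fun h p => Delta p).
- by move=> h v; exact: Delta_ge0.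
- exact: cocc_limit_total.
- move=> h v; rewrite (@cocc_limit_extend _ h.+1.*2 v 1) //.
  by apply: eq_bigl => u; rewrite rhoP.
move=> Y [Yrho YP]; exists Y.
have /choice[X0 X0P] : forall w, exists x, rdom x = setT /\
    forall h, restr h x = rooted (Y h w) (inord h).
  move=> w; apply: rooted_union => [h l|h]; first exact: rdom_rooted_inord.
  apply/restr_finiteP; rewrite inordK; last by lia.
  by rewrite leqnSn subSnn -rhoP Yrho eqxx.
have mX : measurable_fun setT (X0 : T' -> rooted_space R).
  apply: (@measurability _ _ _ (rooted_space R) _ _ open) => //.
  move=> _ [U oU <-]; rewrite setTI.
  (* An open set is covered by the cylinders that it contains, and these are countably many. *)
  have -> : X0 @^-1` U = \bigcup_h \bigcup_(p in [set p : 'S_h.*2.+1 |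
      forall x : rooted_space R, restr h x = rooted p (inord h) -> U x])
      Y h @^-1` [set p].
    apply/seteqP; split => [w /= Uw|w [h _] [p /= pU Yp]]; last first.
      by apply: pU; rewrite (X0P w).2 Yp.
    have [h h0 hU] := restr_nbhs (open_nbhs_nbhs (conj oU Uw)).
    exists h => //; exists (Y h w) => //= x xY; apply: hU.
    by rewrite xY (X0P w).2.
  apply: bigcup_measurable => h _; apply: fin_bigcup_measurable.
    exact: finite_finset.
  by move=> p _; case: (YP h p).
pose X : {RV P' >-> rooted_space R} := HB.pack X0
  (isMeasurableFun.Build _ _ T' (rooted_space R) X0 mX).
exists X; split => // w; split; last by case: (X0P w).
rewrite /rooted_infinite /= (X0P w).1 => /(@finite_preimage _ _ _ Posz).
by move=> H; apply: infinite_nat; apply: H => x y _ _ [].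
Qed.

(** * Convergence in distribution from lower bounds on expectations *)

Section Convergence.
Variables (Y : forall h, T' -> 'S_h.*2.+1) (X : {RV P' >-> rooted_space R}).
Hypothesis YP : forall h p,
  measurable (Y h @^-1` [set p]) /\ P' (Y h @^-1` [set p]) = (Delta p)%:E.
Hypothesis XY : forall w h, restr h (X w) = rooted (Y h w) (inord h).

Section Lower.
Variables (f : rooted_space R -> R) (M : R).
Hypotheses (cf : continuous f) (fM : forall x, `|f x| <= M).

Let cyl h (p : 'S_h.*2.+1) : set (rooted_space R) :=
  [set x | restr h x = rooted p (inord h)].

Let m h (p : 'S_h.*2.+1) : R := inf (f @` cyl p).

Let f_ge x : - M <= f x.
Proof. by have := fM x; rewrite ler_norml => /andP[]. Qed.

Let f_le x : f x <= M.
Proof. by have := fM x; rewrite ler_norml => /andP[]. Qed.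

(** The finite permutation lies in its own cylinder, so the infimum [m p] is over a nonempty set. *)
Let cyl_rooted h (p : 'S_h.*2.+1) : cyl p (rooted p (inord h)).
Proof.
apply/restr_rootedP; split => [l|a b]; last exact: rle_rooted_inord.
by move=> /rdom_rooted_inord; exact.
Qed.

Let m_le h (p : 'S_h.*2.+1) x : cyl p x -> m p <= f x.
Proof.
move=> px; apply: ge_inf; last by exists x.
by exists (- M) => _ [y _ <-].
Qed.

Let le_m h (p : 'S_h.*2.+1) c : (forall x, cyl p x -> c <= f x) -> c <= m p.
Proof.
move=> H; apply: lb_le_inf; last by move=> _ [y py <-]; exact: H.
by exists (f (rooted p (inord h))), (rooted p (inord h)).
Qed.

Let m_norm h (p : 'S_h.*2.+1) : `|m p| <= M.
Proof.
by rewrite ler_norml le_m //= (le_trans (m_le (cyl_rooted p))) ?f_le.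
Qed.

Let m_cvg w : (fun h => m (Y h w)) @ \oo --> f (X w).
Proof.
apply/cvgrPdist_le => e e0.
(* By continuity [f] varies by at most [e] on the cylinder of radius [h0] around [X w], hence so do
   the infima over the smaller cylinders inside it. *)
have := @cf (X w); move/cvgrPdist_le => /(_ e e0) /restr_nbhs[h0 _ Hh0].
near=> h.
have h0h : (h0 <= h)%N by near: h; exact: nbhs_infty_ge.
have mf : m (Y h w) <= f (X w) by apply: m_le; exact: XY.
have fm : f (X w) - e <= m (Y h w).
  apply: le_m => x xY; have /Hh0 : restr h0 (X w) = restr h0 x.
    by apply: (restr_eq_le h0h); rewrite XY xY.
  by rewrite /= ler_norml; lra.
by rewrite ler_norml; lra.
Unshelve. all: by end_near. Qed.

Let measurable_m h : measurable_fun setT (fun w : T' => m (Y h w)).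
Proof.
move=> _ B _; rewrite setTI.
have -> : (fun w => m (Y h w)) @^-1` B =
    \bigcup_(p in [set p | B (m p)]) Y h @^-1` [set p].
  by apply/seteqP; split => [w /= Bw|w [p /= Bp ->]//]; exists (Y h w).
apply: fin_bigcup_measurable; first exact: finite_finset.
by move=> p _; case: (YP p).
Qed.

Let expectation_cvg : exists2 e, 'E_P'[f \o X]%E = e%:E &
  (fun h => - M + \sum_(p : 'S_h.*2.+1) (m p + M) * Delta p) @ \oo --> e.
Proof.
(* In the limit the full balls have total mass 1, so the shift by [M] cancels. *)
have Em h : - M + \sum_(p : 'S_h.*2.+1) (m p + M) * Delta p =
    \sum_(p : 'S_h.*2.+1) m p * Delta p.
  under eq_bigr do rewrite mulrDl.
  by rewrite big_split /= -mulr_sumr cocc_limit_total mulr1 [LHS]addrC addrK.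
have Im h : (\int[P']_w (m (Y h w))%:E =
    (- M + \sum_(p : 'S_h.*2.+1) (m p + M) * Delta p)%:E)%E.
  have := @expectation_fintype _ _ _ P' _ (Y h) (@m h) (fun p => (YP p).1).
  rewrite unlock /= => ->; rewrite Em; congr EFin.
  by apply: eq_bigr => p _; rewrite (YP p).2.
have cvg := @dominated_cvg _ T' R P' setT measurableT
  (fun h w => (m (Y h w))%:E) (fun w => (f (X w))%:E) (cst M%:E).
have {}cvg : (fun h => \int[P']_w (m (Y h w))%:E)%E @ \oo -->
    (\int[P']_w (f (X w))%:E)%E.
  apply: cvg => //.
  - by move=> h; apply/measurable_realfun.measurable_EFinP; exact: measurable_m.
  - by move=> w _; apply/cvg_EFinP; exact: m_cvg.
  - exact: finite_measure_integrable_cst.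
  - by move=> h w _; rewrite /= lee_fin m_norm.
have finE : ('E_P'[f \o X] \is a fin_num)%E.
  by rewrite unlock; apply: integrable_fin_num => //; exact: integrable_continuous.
exists (fine ('E_P'[f \o X])%E); first by rewrite fineK.
apply/cvg_EFinP; rewrite fineK // expectation.unlock.
by move: cvg; under eq_fun do rewrite Im.
Qed.

Lemma expectation_near_ge : exists2 e, 'E_P'[f \o X]%E = e%:E &
  exists2 u : nat -> R,
    forall n, 'E_(P n)[f \o rooted_RV (sigma n) (i n)]%E = (u n)%:E &
    forall eps, 0 < eps -> \forall n \near \oo, e - eps <= u n.
Proof.
have [e eE ecvg] := expectation_cvg; exists e => //.
have lo n h := rooted_RV_expectation_ge (@i_uniform n) (@i_indep n) f_ge (@m_le h).
exists (fun n => fine 'E_(P n)[f \o rooted_RV (sigma n) (i n)]%E) => [n|eps eps0].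
  by have [x -> _] := lo n 0%N.
have e2 : 0 < eps / 2 by lra.
(* The radius is fixed first, from [eps] alone; then [n] grows, and only finitely many patterns of
   that radius have to converge. *)
have [h Hh] : exists h, e - eps / 2 <= - M + \sum_(p : 'S_h.*2.+1) (m p + M) * Delta p.
  have /cvgrPdist_le/(_ _ e2) := ecvg; case=> h _ /(_ h (leqnn h)) /=.
  by rewrite ler_norml => /andP[_ ?]; exists h; lra.
have cvgh : (fun n => - M + \sum_(p : 'S_h.*2.+1) (m p + M) * mean n p) @ \oo -->
    - M + \sum_(p : 'S_h.*2.+1) (m p + M) * Delta p.
  apply: cvgD; first exact: cvg_cst.
  apply: cvg_fin_sum => p; apply: cvgM; first exact: cvg_cst.
  exact: Delta_cvg.
have /cvgrPdist_le/(_ _ e2) := cvgh; apply: filterS => n.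
rewrite ler_norml => /andP[_ H].
have [x -> /= Hx] := lo n h.
lra.
Qed.

End Lower.

Lemma limit_cvg : cvg_in_distribution (fun n => rooted_RV (sigma n) (i n)) X.
Proof.
move=> f cf [M fM].
have [e eE [u uE ue]] := expectation_near_ge cf fM.
have cNf : continuous (fun x => - f x).
  by move=> x; apply: (@cvgN _ _ _ (nbhs x) _ f (f x) (cf x)).
have fNM x : `|- f x| <= M by rewrite normrN.
have [e' e'E [u' u'E u'e]] := expectation_near_ge cNf fNM.
(* The bounds for [f] and [- f] concern the same expectations up to sign, so together they enclose
   [u n] in [[e - eps, e + eps]]. *)
have ue' n : u' n = - u n.
  apply/EFin_inj; rewrite EFinN -uE -u'E.
  exact: (expectation_continuousN (rooted_RV (sigma n) (i n)) cf fM).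
have ee' : e' = - e.
  apply/EFin_inj; rewrite EFinN -eE -e'E.
  exact: (expectation_continuousN X cf fM).
rewrite eE (_ : (fun n => 'E_(P n)[_]%E) = (fun n => (u n)%:E)); last exact/funext.
apply/cvg_EFinP/cvgrPdist_le => eps eps0; near=> n.
have : e - eps <= u n by near: n; exact: ue.
have : e' - eps <= u' n by near: n; exact: u'e.
by rewrite ue' ee' ler_norml; lra.
Unshelve. all: by end_near. Qed.

End Convergence.

End Construction.

End Limits.

Theorem theorem2p24 (R : realType) (d : nat -> measure_display)
    (T : forall n, measurableType (d n)) (P : forall n, probability (T n) R)
    (* the random permutation of size n + 1 and the random root *)
    (sigma : forall n, {RV (P n) >-> 'S_n.+1})
    (i : forall n, {RV (P n) >-> 'I_n.+1})
    (i_uniform : forall n, uniform_index (i n))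
    (i_indep : forall n, independent_RV (sigma n) (i n)) :
  [<-> exists (d' : measure_display) (T' : measurableType d')
         (P' : probability T' R) (X : {RV P' >-> rooted_space R}),
         BS_limit sigma i X;
       forall h : nat, (0 < h)%N ->
         exists Gamma : 'S_h.*2.+1 -> R, ball_limit sigma i Gamma;
       exists Delta : forall k, 'S_k.+1 -> R, cocc_limit sigma Delta]
  /\
  forall (d' : measure_display) (T' : measurableType d')
      (P' : probability T' R) (X : {RV P' >-> rooted_space R})
      (h : nat) (Gamma : 'S_h.*2.+1 -> R) (Delta : forall k, 'S_k.+1 -> R),
    (0 < h)%N -> BS_limit sigma i X -> ball_limit sigma i Gamma ->
    cocc_limit sigma Delta ->
    forall p : 'S_h.*2.+1,
      P' [set w | restr h (X w) = rooted p (inord h)] = (Delta h.*2 p)%:E /\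
      Delta h.*2 p = Gamma p.
Proof.
split.
  tfae.
  - move=> [d' [T' [P' [X XBS]]]] h h0.
    exists (fun p => fine (P' [set w | restr h (X w) = rooted p (inord h)])).
    apply/(ball_limitE i_uniform i_indep) => p.
    by split; [exact: fine_ge0 | exact: (BS_limit_ball i_uniform i_indep)].
  - exact: ball_limit_cocc i_uniform i_indep.
  - move=> [Delta HDelta].
    have [Y [X [YP XP]]] := limit_exists HDelta.
    exists _, _, _, X; split=> [w|]; first by case: (XP w).
    apply: (limit_cvg i_uniform i_indep HDelta YP) => w h.
    by case: (XP w).
move=> d' T' P' X h Gamma Delta _ XBS /(ball_limitE i_uniform i_indep) HG.
move=> /cocc_limitE HD p.
(* All three quantities are limits of the one sequence of mean proportions of [p], hence equal. *)
have cX := @BS_limit_ball _ _ _ _ _ _ i_uniform i_indep _ _ _ _ _ p XBS.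
have [_ cG] := HG p; have [_ cD] := HD _ p.
split; last exact: cvg_unique cD cG.
rewrite (cvg_unique _ cD cX) // fineK // fin_num_measure //.
apply: (measurable_preimage_RV X (A := [set x | restr h x = rooted p (inord h)])).
by apply: measurable_open; exact: open_restr.
Qed.
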